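(* Let $\{f_k\}_{k=0}^\infty$ be any sequence of decision functions defining a causal and measurable algorithm for the example system described in the context. There is a parameter $q\in[1/4,3/4]$ such that, using these decision functions with an i.i.d. Bernoulli-$q$ process $\{S[k]\}_{k=0}^\infty$ and an independent uniform random variable $U$, the resulting decisions $(T[k],R[k])\in\mathcal{D}(S[k])$ satisfy $$\frac{\sum_{k=0}^{K-1}\mathbb{E}[R[k]]}{\sum_{k=0}^{K-1}\mathbb{E}[T[k]]}\le\theta^*-\Omega\!\left(\frac{\log K}{K}\right),$$ i.e., there exist $c>0$ and a positive integer $K_0$ such that the left-hand side is at most $\theta^*-c\,\frac{\log K}{K}$ for all integers $K\ge K_0$. Here $\theta^*=2-\frac{2}{q}\left(-1+\sqrt{1+q}\right)$ is the optimal ratio for parameter $q$. In particular, no algorithm can have error that decays faster than $\Omega(\log(K)/K)$.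
   Context: Example system: $\{S[k]\}_{k=0}^\infty$ is i.i.d. with $P[S[k]=1]=q$ and $P[S[k]=0]=1-q$, where $q\in[1/4,3/4]$ is a parameter unknown to the controller. The decision sets are $\mathcal{D}(0)=\{(1,1)\}$ and $\mathcal{D}(1)=\{(x,\,2-(2-x)^2):x\in[1,2]\}$. Causal and measurable algorithm: let $U$ be uniform on $[0,1)$, independent of $\{S[k]\}_{k=0}^\infty$, and let $H[k]=(S[0],\ldots,S[k-1])$ for $k\ge1$ (with $H[0]$ empty). A causal and measurable algorithm is given by a sequence of deterministic measurable functions $f_k:\{0,1\}^k\times[0,1]\to\mathcal{D}(1)$, $k\in\{0,1,2,\ldots\}$ ($f_0$ depends only on $u\in[0,1]$), via $(T[k],R[k])=(1,1)$ if $S[k]=0$ and $(T[k],R[k])=f_k(H[k],U)$ if $S[k]=1$. The functions $f_k$ do not depend on $q$. Optimal ratio: $\theta^*$ is the supremum of $r/t$ over all pairs $(t,r)=(\mathbb{E}[T[0]],\mathbb{E}[R[0]])$ achievable by (measurable, possibly randomized) choices $(T[0],R[0])\in\mathcal{D}(S[0])$ given $S[0]$; for this system it equals $2-\frac{2}{q}(-1+\sqrt{1+q})$. *)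

(* Defs.v *)
(* Library: MathComp + MathComp-Analysis, over an arbitrary R : realType. *)
From mathcomp Require Import all_boot all_order all_algebra.
From mathcomp Require Import all_classical all_reals all_analysis.
Set Implicit Arguments.
Unset Strict Implicit.
Unset Printing Implicit Defensive.
Import Order.TTheory GRing.Theory Num.Theory.
Import numFieldNormedType.Exports.
Local Open Scope classical_set_scope.
Local Open Scope ring_scope.

(* The states 0 and 1 are encoded as false and true; a decision is a pair
   (T, R) of a task duration and a reward. *)
Definition decision_set (R : realType) (s : bool) : set (R * R) :=
  if s then [set (x, 2 - (2 - x) ^+ 2) | x in `[1, 2]] else [set (1, 1)].

(* Mutual independence: product rule over every finite subfamily. *)
Definition mutually_independent (R : realType) (d d' : measure_display)
    (Omega : measurableType d) (T : measurableType d')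
    (P : probability Omega R) (X : nat -> {RV P >-> T}) : Prop :=
  forall (J : seq nat) (B : nat -> set T),
    uniq J -> (forall j, measurable (B j)) ->
    P (\bigcap_(j in [set` J]) (X j @^-1` B j)) =
    (\prod_(j <- J) P (X j @^-1` B j))%E.

Definition iid_bernoulli (R : realType) (d : measure_display)
    (Omega : measurableType d) (P : probability Omega R)
    (q : R) (S : nat -> {RV P >-> bool}) : Prop :=
  (forall k, distribution P (S k) =1 bernoulli_prob q) /\
  mutually_independent S.

(* The range condition holds everywhere, not just almost surely: decision
   functions are only constrained for randomizers in [0, 1]. *)
Definition uniform01 (R : realType) (d : measure_display)
    (Omega : measurableType d) (P : probability Omega R)
    (U : {RV P >-> R}) : Prop :=
  (forall w, 0 <= U w < 1) /\
  (forall A : set R, measurable A ->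
     distribution P U A = uniform_prob (@ltr01 R) A).

Definition sigma_process (R : realType) (d d' : measure_display)
    (Omega : measurableType d) (T : measurableType d')
    (P : probability Omega R) (X : nat -> {RV P >-> T}) : set (set Omega) :=
  <<s [set E | exists k (B : set T), measurable B /\ E = X k @^-1` B] >>.

Definition independent_of_process (R : realType) (d d' d'' : measure_display)
    (Omega : measurableType d) (T : measurableType d')
    (T' : measurableType d'') (P : probability Omega R)
    (U : {RV P >-> T'}) (X : nat -> {RV P >-> T}) : Prop :=
  forall (A : set T') (E : set Omega),
    measurable A -> sigma_process X E ->
    P (U @^-1` A `&` E) = (P (U @^-1` A) * P E)%E.

(* f k (h, u) is the decision taken in slot k when S[k] = 1, given the history
   h = (S[0], ..., S[k-1]) and the randomizer u in [0, 1]; the values of f k at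
   u outside [0, 1] are irrelevant. *)
Definition causal_measurable_algorithm (R : realType)
    (f : forall k : nat, k.-tuple bool * R -> R * R) : Prop :=
  forall k : nat,
    measurable_fun ([set: k.-tuple bool] `*` `[0 : R, 1]) (f k) /\
    (forall (h : k.-tuple bool) (u : R),
       0 <= u <= 1 -> decision_set true (f k (h, u))).

Definition decision (R : realType) (d : measure_display)
    (Omega : measurableType d) (P : probability Omega R)
    (f : forall k : nat, k.-tuple bool * R -> R * R)
    (S : nat -> {RV P >-> bool}) (U : {RV P >-> R}) (k : nat) (w : Omega)
    : R * R :=
  if S k w then f k ([tuple S i w | i < k], U w) else (1, 1).

(* The expectations below are of bounded variables, hence finite, so taking
   the real part with fine loses nothing. *)
Definition time_average_ratio (R : realType) (d : measure_display)
    (Omega : measurableType d) (P : probability Omega R)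
    (f : forall k : nat, k.-tuple bool * R -> R * R)
    (S : nat -> {RV P >-> bool}) (U : {RV P >-> R}) (K : nat) : R :=
  (\sum_(0 <= k < K) fine 'E_P[fun w => (decision f S U k w).2]) /
  (\sum_(0 <= k < K) fine 'E_P[fun w => (decision f S U k w).1]).

(* Randomization is modelled by letting the probability space be arbitrary:
   the decision need not be a function of the state. *)
Definition achievable (R : realType) (q : R) : set (R * R) :=
  [set p | exists (d : measure_display) (Omega : measurableType d)
      (P : probability Omega R) (S0 : {RV P >-> bool})
      (T0 R0 : {RV P >-> R}),
    [/\ distribution P S0 =1 bernoulli_prob q,
        forall w, decision_set (S0 w) (T0 w, R0 w)
      & p = (fine 'E_P[T0], fine 'E_P[R0])]].

Definition optimal_ratio (R : realType) (q : R) : R :=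
  sup [set p.2 / p.1 | p in achievable q].

(* Main.v *)
Require Import Defs.
From mathcomp Require Import all_boot all_order all_algebra.
From mathcomp Require Import all_classical all_reals all_analysis.
From mathcomp Require Import measurable_realfun ring lra.
Set Implicit Arguments.
Unset Strict Implicit.
Unset Printing Implicit Defensive.
Import Order.TTheory GRing.Theory Num.Theory.
Import numFieldNormedType.Exports.
Local Open Scope classical_set_scope.
Local Open Scope ring_scope.

(** With x = 1 + 1 / (1 + sqrt (1 + q)) one has theta* = 2 (2 - x), and for every
    decision with duration T taken in state 1 the gain R - theta* T falls short
    of its maximum by exactly (T - x)^2.  By Jensen's inequality T may be replaced
    by its mean given the history, so that the loss accumulated up to time K is at
    least q times a sum of mean square errors of estimators of x that only see k
    Bernoulli samples.  Le Cam's two-point method bounds from below the sum of the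
    errors at two parameters at distance of order 1 / sqrt k by a multiple of 1 / k.
    Hence on an interval of length of order 3^-m the errors of the times in
    [9^m, 9^(m+1)) add up to at least a constant on the whole left third or on the
    whole right third, and nested thirds shrink to a single q whose accumulated
    error gains a constant in each of these blocks. *)

(** * Two-point lower bounds from Bernoulli samples *)

Lemma sum_tuple_prod (R : comPzSemiRingType) (k : nat) (F : bool -> R) :
  \sum_(h : k.-tuple bool) \prod_(i < k) F (tnth h i) = (F true + F false) ^+ k.
Proof.
have -> : (F true + F false) ^+ k = \prod_(i < k) \sum_(b : bool) F b.
  by rewrite big_const_ord iter_mulr_1 big_bool.
rewrite bigA_distr_bigA /=.
rewrite [RHS](reindex (fun h : k.-tuple bool => [ffun i => tnth h i])) /=;
  last first.
  exists (fun g : {ffun 'I_k -> bool} => [tuple g i | i < k]) => x _.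
    by apply: eq_from_tnth => i; rewrite tnth_mktuple ffunE.
  by apply/ffunP => i; rewrite ffunE tnth_mktuple.
by apply: eq_bigr => h _; apply: eq_bigr => i _; rewrite ffunE.
Qed.

(** The likelihood of the sample [h] under independent Bernoulli-[p] draws, kept purely algebraic so
    that the estimation bounds involve no probability space. *)
Definition bernoulli_weight (R : pzRingType) (p : R) (k : nat)
    (h : k.-tuple bool) : R :=
  \prod_(i < k) (if tnth h i then p else 1 - p).

Lemma sum_bernoulli_weight (R : comPzRingType) (p : R) k :
  \sum_(h : k.-tuple bool) bernoulli_weight p h = 1.
Proof.
rewrite (sum_tuple_prod _ (fun b : bool => if b then p else 1 - p)).
by rewrite addrC subrK expr1n.
Qed.

(** The base of the power is the Hellinger affinity of the two Bernoulli laws. It tensorises: the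
    geometric means [r h] of the two likelihoods sum to its [k]-th power. As [a h] cannot be close
    to both [x] and [x'], the triangle inequality under the weights [r h], followed by
    Cauchy-Schwarz, gives the bound. *)
Lemma two_point_bound (R : rcfType) (k : nat) (a : k.-tuple bool -> R)
    (p p' x x' : R) :
  0 <= p <= 1 -> 0 <= p' <= 1 ->
  (x - x') ^+ 2
      * (Num.sqrt (p * p') + Num.sqrt ((1 - p) * (1 - p'))) ^+ (2 * k) / 2
  <= \sum_h bernoulli_weight p h * (a h - x) ^+ 2
     + \sum_h bernoulli_weight p' h * (a h - x') ^+ 2.
Proof.
move=> /andP[p0 p1] /andP[p'0 p'1].
set L := \sum_h _; set L' := \sum_h _.
pose r (h : k.-tuple bool) := \prod_(i < k)
  (if tnth h i then Num.sqrt (p * p') else Num.sqrt ((1 - p) * (1 - p'))).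
set rho := Num.sqrt _ + Num.sqrt _.
have rE : \sum_h r h = rho ^+ k.
  exact: (sum_tuple_prod _ (fun b : bool =>
    if b then Num.sqrt (p * p') else Num.sqrt ((1 - p) * (1 - p')))).
have w0 q h : 0 <= q <= 1 -> 0 <= @bernoulli_weight R q k h.
  move=> /andP[q0 q1]; apply: prodr_ge0 => i _.
  by case: ifP => _ //; rewrite subr_ge0.
have r2 h : r h ^+ 2 = bernoulli_weight p h * bernoulli_weight p' h.
  rewrite /r /bernoulli_weight -prodrXl -big_split /=; apply: eq_bigr => i _.
  by case: ifP => _; rewrite sqr_sqrtr// mulr_ge0// subr_ge0.
have r0 h : 0 <= r h.
  by apply: prodr_ge0 => i _; case: ifP => _; exact: sqrtr_ge0.
have L0 : 0 <= L.
  by apply: sumr_ge0 => h _; rewrite mulr_ge0 ?sqr_ge0// w0// p0.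
have L'0 : 0 <= L'.
  by apply: sumr_ge0 => h _; rewrite mulr_ge0 ?sqr_ge0// w0// p'0.
pose e := `|x - x'| * rho ^+ k.
have -> : (x - x') ^+ 2 * rho ^+ (2 * k) = e ^+ 2.
  by rewrite /e exprMn real_normK ?num_real// mulnC exprM.
have rho0 : 0 <= rho by rewrite addr_ge0// sqrtr_ge0.
have e0 : 0 <= e by rewrite mulr_ge0// exprn_ge0.
(* AM-GM: [s |z| <= (t u z^2 + v / t) / 2] whenever [s^2 = u v]; the sum over [h]
   is later optimised at [t = 2 / e]. *)
have amgm (t : R) : 0 < t -> e <= (t * (L + L') + 2 / t) / 2.
  move=> t0.
  have am u v s : 0 <= u -> 0 <= v -> 0 <= s -> s ^+ 2 = u * v ->
      forall z : R, s * `|z| <= (t * (u * z ^+ 2) + v / t) / 2.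
    move=> u0 v0 s0 suv z.
    have t'0 : 0 <= (t * (u * z ^+ 2) + v / t) / 2.
      by rewrite divr_ge0// addr_ge0 ?divr_ge0 ?(ltW t0)//
        mulr_ge0 ?(ltW t0)// mulr_ge0 ?sqr_ge0.
    rewrite -(@ler_pXn2r _ 2)// ?nnegrE ?mulr_ge0//.
    rewrite exprMn real_normK ?num_real// suv.
    have := leif_AGM2 (t * (u * z ^+ 2)) (v / t) => -[+ _].
    apply: le_trans; rewrite le_eqVlt; apply/orP; left; apply/eqP.
    by field; rewrite gt_eqF.
  rewrite /e -rE mulr_sumr.
  (* Each squared error keeps its own likelihood, while the other likelihood goes into the [1 / t]
     term; both likelihoods sum to 1, whence [2 / t]. *)
  have -> : (t * (L + L') + 2 / t) / 2 =
    \sum_h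
     ((t * (bernoulli_weight p h * (a h - x) ^+ 2) + bernoulli_weight p' h / t) / 2
      + (t * (bernoulli_weight p' h * (a h - x') ^+ 2)
         + bernoulli_weight p h / t) / 2).
    rewrite big_split/= -!mulr_suml !big_split/= -!mulr_suml -!mulr_sumr.
    by rewrite !sum_bernoulli_weight -/L -/L'; field; rewrite gt_eqF.
  apply: ler_sum => h _.
  have -> : x - x' = (a h - x') - (a h - x) by ring.
  rewrite mulrC; apply: le_trans (_ : r h * (`|a h - x| + `|a h - x'|) <= _).
    by rewrite ler_wpM2l// [leRHS]addrC ler_normB.
  rewrite mulrDr lerD//; apply: am; rewrite ?w0 ?p0 ?p'0 ?r2//.
  by rewrite mulrC.
have [->|en0] := eqVneq e 0; first by rewrite expr0n/= mul0r addr_ge0.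
have {en0}e0' : 0 < e by rewrite lt_neqAle eq_sym en0.
have := amgm (2 / e) (divr_gt0 (ltr0Sn _ _) e0').
have -> : (2 / e * (L + L') + 2 / (2 / e)) / 2 = (L + L') / e + e / 2.
  by field; rewrite gt_eqF.
rewrite -lerBlDr ler_pdivlMr//.
by have -> : (e - e / 2) * e = e ^+ 2 / 2 by field.
Qed.

(** For [u], [v] at least 1/4 the square roots [s], [t] satisfy [s + t >= 1], so
    [u + v - 2 s t = (s - t)^2 <= (u - v)^2]. This is applied to [p], [p'] and to their
    complements. *)
Lemma bernoulli_affinity_ge (R : rcfType) (p p' : R) :
  1 / 4 <= p <= 3 / 4 -> 1 / 4 <= p' <= 3 / 4 ->
  1 - (p - p') ^+ 2 <= Num.sqrt (p * p') + Num.sqrt ((1 - p) * (1 - p')).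
Proof.
have half (u v : R) : 1 / 4 <= u -> 1 / 4 <= v ->
    (u + v - (u - v) ^+ 2) / 2 <= Num.sqrt (u * v).
  move=> u4 v4; have u0 : 0 <= u by lra. have v0 : 0 <= v by lra.
  rewrite sqrtrM//.
  set s := Num.sqrt u; set t := Num.sqrt v.
  have : 1 / 2 <= s.
    by rewrite -(@ler_pXn2r _ 2) ?nnegrE ?sqrtr_ge0// sqr_sqrtr//; lra.
  have : 1 / 2 <= t.
    by rewrite -(@ler_pXn2r _ 2) ?nnegrE ?sqrtr_ge0// sqr_sqrtr//; lra.
  have -> : u = s ^+ 2 by rewrite sqr_sqrtr.
  have -> : v = t ^+ 2 by rewrite sqr_sqrtr.
  move=> t2 s2.
  have : 0 <= (s - t) ^+ 2 * ((s + t) ^+ 2 - 1).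
    by rewrite mulr_ge0 ?sqr_ge0// subr_ge0 exprn_ege1//; lra.
  by nra.
move=> p4 p'4.
have := half p p'; have := half (1 - p) (1 - p').
by lra.
Qed.

(** * The optimal duration as a function of the parameter *)

(** For nonzero [q] this is the rationalised form of [1 + (sqrt (1 + q) - 1) / q], the duration that
    maximises [R - theta* T] in state 1. *)
Definition optimal_duration (R : rcfType) (q : R) : R :=
  1 + (1 + Num.sqrt (1 + q))^-1.

(** With [s], [t] the square roots of [1 + p] and [1 + p'], the two distances differ by the factor
    [(s + t) (1 + s) (1 + t)]. Both roots are at most 3/2, so this factor is at most 75/4, hence at
    most 20. *)
Lemma optimal_duration_sep (R : rcfType) (p p' : R) :
  0 <= p <= 5 / 4 -> 0 <= p' <= 5 / 4 ->
  `|p - p'| / 20 <= `|optimal_duration p - optimal_duration p'|.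
Proof.
move=> p4 p'4; rewrite /optimal_duration.
have rt (u : R) : 0 <= u <= 5 / 4 -> 0 <= Num.sqrt (1 + u) <= 3 / 2.
  move=> u4; rewrite sqrtr_ge0/= -(@ler_pXn2r _ 2) ?nnegrE ?sqrtr_ge0//.
  by rewrite sqr_sqrtr; nra.
have -> : p - p' = Num.sqrt (1 + p) ^+ 2 - Num.sqrt (1 + p') ^+ 2.
  by rewrite !sqr_sqrtr; lra.
have := rt _ p4; have := rt _ p'4.
move: (Num.sqrt (1 + p)) (Num.sqrt (1 + p')) => s t t2 s2.
have -> : 1 + (1 + s)^-1 - (1 + (1 + t)^-1) = (t - s) / ((1 + s) * (1 + t)).
  by field; apply/andP; split; lra.
rewrite subr_sqr !normrM normfV (distrC t) -mulrA ler_wpM2l//.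
rewrite (_ : `|s + t| = s + t); last by rewrite ger0_norm//; lra.
rewrite (_ : `|_ * _| = (1 + s) * (1 + t)); last by rewrite ger0_norm//; nra.
rewrite -[leRHS]mul1r ler_pdivlMr; last by nra.
by nra.
Qed.

(** * Nested intervals and logarithmic accumulation of the error *)

(** Stage [m] has an interval of length [3 ^- m / 2], starting from [1/4, 3/4]. Points in its
    opposite outer thirds are at a distance between a third of that length and the whole length,
    which is the range assumed for [p] and [p']. *)
Lemma nested_thirds (R : realType) (B : nat -> R -> R) (c : R) :
  (forall m p p', 1 / 4 <= p <= 3 / 4 -> 1 / 4 <= p' <= 3 / 4 ->
    3 ^- m / 6 <= `|p - p'| <= 3 ^- m / 2 -> 2 * c <= B m p + B m p') ->
  exists2 q, 1 / 4 <= q <= 3 / 4 & forall m, c <= B m q.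
Proof.
move=> sep.
(* A point of the left third where [B m] is below [c] forces [B m] to be at least
   [c] on the whole right third. *)
pose step m x := if `[< forall p, x <= p <= x + 3 ^- m.+1 / 2 -> c <= B m p >]
  then x else x + 3 ^- m.+1.
pose fix a m := if m is m'.+1 then step m' (a m') else 1 / 4.
have l0 m : 0 < 3 ^- m :> R by rewrite invr_gt0 exprn_gt0.
have lS m : 3 ^- m = 3 * 3 ^- m.+1 :> R.
  by rewrite exprS invfM mulrA divff ?mul1r// pnatr_eq0.
have aS m : a m <= a m.+1 /\ a m.+1 + 3 ^- m.+1 / 2 <= a m + 3 ^- m / 2.
  rewrite /= /step; have := l0 m.+1; rewrite (lS m).
  by case: ifP => _ ?; split; lra.
have a_mono m n : (m <= n)%N -> a m <= a n.
  by move=> mn; apply: (@homo_leq _ a (fun x y => x <= y)) => // [y x z|i];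
    [exact: le_trans|have [] := aS i].
have b_mono m n : (m <= n)%N -> a n + 3 ^- n / 2 <= a m + 3 ^- m / 2.
  move=> mn; apply: (@homo_leq _ (fun i => a i + 3 ^- i / 2)
    (fun x y => y <= x)) => // [y x z yx zy|i].
    exact: le_trans zy yx.
  by have [] := aS i.
have ab m n : a m <= a n + 3 ^- n / 2.
  have [mn|/ltnW nm] := leqP m n.
    by have := a_mono _ _ mn; have := l0 n; lra.
  by have := b_mono _ _ nm; have := l0 m; lra.
(* Every left endpoint is below every right endpoint, so the supremum of the left endpoints lies in
   all the intervals. *)
have qP n : a n <= sup (range a) <= a n + 3 ^- n / 2.
  apply/andP; split.
    apply: ub_le_sup; last by exists n.
    by exists (a n + 3 ^- n / 2) => _ [m _ <-].
  by apply: ge_sup; [exists (a 0%N), 0%N|move=> _ [m _ <-]].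
have a4 n : 1 / 4 <= a n /\ a n + 3 ^- n / 2 <= 3 / 4.
  split; first exact: (a_mono 0%N n).
  by apply: le_trans (b_mono 0%N n _) _ => //=; rewrite expr0 invr1; lra.
exists (sup (range a)).
  by have := qP 0%N; rewrite /= expr0 invr1; lra.
move=> m; have := qP m.+1.
have [am bm] := a4 m; have lm := l0 m.+1; have lSm := lS m; move: bm.
rewrite lSm => bm.
rewrite /= /step; case: ifPn => [/asboolP + ?|/asboolP]; first exact.
rewrite -existsNP => -[p] /not_implyP[p1 /negP]; rewrite -ltNge => p2 q1.
move: (sup _) q1 => q q1.
have : 2 * c <= B m p + B m q.
  apply: sep; [lra|lra|].
  by rewrite lSm distrC ger0_norm; lra.
by lra.
Qed.

Definition mean_sq_error (R : rcfType) (a : forall k : nat, k.-tuple bool -> R)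
    (k : nat) (p : R) : R :=
  \sum_h bernoulli_weight p h * (a k h - optimal_duration p) ^+ 2.

(** In this block [k] is of order [9 ^ m] and [(p - p')^2] of order [9 ^- m], so the affinity to the
    power [2 * k] stays bounded below. Each of the [8 * 9 ^ m] times then contributes a constant
    multiple of [9 ^- m], and [m] cancels from the total. *)
Lemma mean_sq_error_block (R : rcfType) (a : forall k : nat, k.-tuple bool -> R)
    (m : nat) (p p' : R) :
  1 / 4 <= p <= 3 / 4 -> 1 / 4 <= p' <= 3 / 4 ->
  3 ^- m / 6 <= `|p - p'| <= 3 ^- m / 2 ->
  2 * ((3 / 4) ^+ 18 / 18 / 20 ^+ 2) <=
    \sum_(9 ^ m <= k < 9 ^ m.+1) mean_sq_error a k p
    + \sum_(9 ^ m <= k < 9 ^ m.+1) mean_sq_error a k p'.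
Proof.
move=> p4 p'4 pp'.
pose x : R := (9 ^ m)%:R^-1.
have N0 : 0 < (9 ^ m)%:R :> R by rewrite ltr0n expn_gt0.
have x0 : 0 < x by rewrite invr_gt0.
have x1 : x <= 1 by rewrite invf_le1// ler1n expn_gt0.
have x2 : (3 ^- m) ^+ 2 = x.
  by rewrite /x natrX exprVn -exprM mulnC exprM -natrX.
have d2 : x / 36 <= (p - p') ^+ 2 <= x / 4.
  rewrite -x2 -[(p - p') ^+ 2]real_normK ?num_real//.
  have : 0 < 3 ^- m :> R by rewrite invr_gt0 exprn_gt0.
  by move: pp'; move: (3 ^- m) `|_| => u v; nra.
have rho : 1 - x / 4 <= Num.sqrt (p * p') + Num.sqrt ((1 - p) * (1 - p')).
  by apply: le_trans (bernoulli_affinity_ge p4 p'4); lra.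
have term k : (k < 9 ^ m.+1)%N ->
    x * ((3 / 4) ^+ 18 / 36 / 20 ^+ 2 / 2) <=
      mean_sq_error a k p + mean_sq_error a k p'.
  move=> kN.
  apply: le_trans (two_point_bound _ _ _ _ _); [|lra|lra].
  have xx : x / 36 / 20 ^+ 2 <= (optimal_duration p - optimal_duration p') ^+ 2.
    have := @optimal_duration_sep R p p'.
    rewrite -(real_normK (num_real (optimal_duration _ - _))).
    rewrite -(real_normK (num_real (p - p'))) in d2.
    have := normr_ge0 (p - p').
    move: d2; move: `|_| `|_| => u v d2 v0 uv.
    have {}uv : v / 20 <= u by apply: uv; lra.
    by nra.
  rewrite (_ : x * _ = x / 36 / 20 ^+ 2 * (3 / 4) ^+ 18 / 2); last first.
    by move: (_ ^+ 18) => y; field.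
  rewrite ler_wpM2r// ler_pM//; [by rewrite divr_ge0 ?divr_ge0 ?(ltW x0)|].
  apply: (@le_trans _ _ ((1 - x / 4) ^+ (2 * k))); last first.
    by apply: lerXn2r; rewrite ?nnegrE; lra.
  (* In the block [2 * k] is at most [2 * 9 ^ m.+1 = 9 ^ m * 18], and Bernoulli's inequality bounds
     the power [9 ^ m] below by 3/4; hence the constant [(3 / 4) ^+ 18]. *)
  apply: (@le_trans _ _ ((1 - x / 4) ^+ (9 ^ m * 18))).
    have y0 : 0 <= 1 - x / 4 by lra.
    rewrite exprM; apply: lerXn2r; rewrite ?nnegrE ?exprn_ge0//.
    have bern n : 1 - n%:R * (x / 4) <= (1 - x / 4) ^+ n.
      elim: n => [|n IH]; first by rewrite expr0 mul0r subr0.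
      rewrite exprS -natr1; have : 0 <= n%:R :> R by [].
      by move: IH; move: (_ ^+ n) n%:R => u v; nra.
    apply: le_trans (bern _); rewrite mulrA divff ?gt_eqF//; lra.
  apply: ler_wiXn2l; [lra|lra|].
  rewrite (_ : (9 ^ m * 18 = 2 * 9 ^ m.+1)%N) ?leq_mul2l 1?ltnW//.
  by rewrite expnS mulnA mulnC.
rewrite -big_split/=.
apply: (@le_trans _ _ (\sum_(9 ^ m <= k < 9 ^ m.+1)
    (x * ((3 / 4) ^+ 18 / 36 / 20 ^+ 2 / 2)))); last first.
  by apply: ler_sum_nat => k /andP[_]; exact: term.
rewrite sumr_const_nat (_ : (_ - _)%N = (9 ^ m * 8)%N); last first.
  by rewrite expnS -{2}[(9 ^ m)%N]mul1n -mulnBl mulnC.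
rewrite -[leRHS]mulr_natr natrM /x.
move: (_ ^+ 18) => y; rewrite le_eqVlt; apply/orP; left; apply/eqP.
by field; rewrite gt_eqF.
Qed.

Lemma exists_log_error (R : realType) (a : forall k : nat, k.-tuple bool -> R) :
  exists2 q, 1 / 4 <= q <= 3 / 4
    & exists2 c, 0 < c & forall K, (9 <= K)%N ->
        c * ln K%:R <= \sum_(0 <= k < K) mean_sq_error a k q.
Proof.
have [q q4 qB] := nested_thirds (fun m p p' => @mean_sq_error_block R a m p p').
exists q => //.
pose c : R := (3 / 4) ^+ 18 / 18 / 20 ^+ 2.
have c0 : 0 < c by rewrite /c !divr_gt0 ?exprn_gt0// divr_gt0.
have M0 k : 0 <= mean_sq_error a k q.
  apply: sumr_ge0 => h _; rewrite mulr_ge0 ?sqr_ge0//.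
  by apply: prodr_ge0 => i _; case: ifP => _; lra.
have sumB m : m%:R * c <= \sum_(0 <= k < 9 ^ m) mean_sq_error a k q.
  elim: m => [|m IH]; first by rewrite mul0r sumr_ge0.
  rewrite (@big_cat_nat _ _ _ (9 ^ m))//= ?leq_exp2l//.
  by rewrite -natr1 mulrDl mul1r lerD// qB.
have ln9 : 0 < ln 9 :> R by rewrite ln_gt0// ltr1n.
(* With [m] the integer part of the base-9 logarithm of [K], the blocks below [9 ^ m] yield [m * c].
   Since [K >= 9] gives [m >= 1], [ln K <= (m + 1) ln 9 <= 2 m ln 9]. *)
exists (c / (2 * ln 9)) => [|K K9]; first by rewrite divr_gt0// mulr_gt0.
have K0 : (0 < K)%N by apply: leq_trans K9.
have /andP[mK Km] := @trunc_log_bounds 9 K isT K0.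
set m := trunc_log 9 K in mK Km.
have m1 : (1 <= m)%N by rewrite (@trunc_log_max 9 K 1).
apply: (@le_trans _ _ (m%:R * c)); last first.
  apply: le_trans (sumB m) _.
  by rewrite [leRHS](@big_cat_nat _ _ _ (9 ^ m))//= lerDl sumr_ge0.
have : ln K%:R <= m.+1%:R * ln 9 :> R.
  rewrite mulr_natl -lnXn// -natrX ler_ln ?posrE ?ltr0n ?expn_gt0//.
  by rewrite ler_nat ltnW.
rewrite mulrAC ler_pdivrMr ?mulr_gt0// -natr1.
have : 1 <= m%:R :> R by rewrite ler1n.
move: (ln K%:R) (ln 9) m%:R ln9 => x y z y0 z1 xyz.
by rewrite [leRHS]mulrAC mulrC ler_wpM2r ?(ltW c0)//; nra.
Qed.

(** * Expectations of decisions given the history *)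

(** Independence says that the push-forward along [U] of [P] restricted to [A] is [P A] times the
    law of [U]; the formula is the change of variables for this measure. *)
Lemma ge0_integral_indep_event (R : realType) (d d' : measure_display)
    (Omega : measurableType d) (T : measurableType d')
    (P : probability Omega R) (U : {RV P >-> T}) (A : set Omega)
    (g : T -> \bar R) :
  measurable A ->
  (forall B, measurable B -> P (U @^-1` B `&` A) = (P (U @^-1` B) * P A)%E) ->
  measurable_fun setT g -> (forall u, (0 <= g u)%E) ->
  (\int[P]_(w in A) g (U w) = P A * \int[distribution P U]_u g u)%E.
Proof.
move=> mA indep mg g0.
have mU : measurable_fun setT U by [].
have mgU : measurable_fun setT (g \o U) by exact: measurableT_comp.
pose PA := mrestr P mA.
have PA0 : 0 <= fine (P A) by rewrite fine_ge0.
transitivity (\int[PA]_(w in A) g (U w))%E.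
  apply: eq_measure_integral => B mB BA.
  by rewrite /= /mrestr setIidl.
transitivity (\int[PA]_w g (U w))%E.
  rewrite [RHS](@ge0_negligible_integral _ _ _ _ _ (~` A))//=.
  - by rewrite setTD setCK.
  - exact: measurableC.
  - by rewrite /mrestr setICl measure0.
rewrite -[LHS](@ge0_integral_pushforward _ _ _ _ _ _ mU PA setT g)//.
transitivity (\int[mscale (NngNum PA0) (distribution P U)]_u g u)%E.
  apply: eq_measure_integral => B mB _.
  change (P (U @^-1` B `&` A) = ((fine (P A))%:E * P (U @^-1` B))%E).
  by rewrite indep// fineK ?fin_num_measure// muleC.
by rewrite ge0_integral_mscale//= fineK ?fin_num_measure.
Qed.

(** Since [h] has size [k], its entry at index [k] is the default [true]. The condition on slot [k]
    thus joins those on the earlier slots in one finite intersection, the shape required by mutual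
    independence. *)
Lemma history_eventE (R : realType) (d : measure_display)
    (Omega : measurableType d) (P : probability Omega R)
    (S : nat -> {RV P >-> bool}) (k : nat) (h : k.-tuple bool) :
  [set w | S k w /\ [tuple S i w | i < k] = h] =
  \bigcap_(j in [set` iota 0 k.+1]) (S j @^-1` [set nth true h j]).
Proof.
have memP j : [set` iota 0 k.+1] j <-> (j <= k)%N.
  by rewrite /mkset mem_iota add0n ltnS.
apply/seteqP; split => w.
  move=> [Sk <-] j /memP; rewrite leq_eqVlt => /orP[/eqP ->|jk];
    rewrite /preimage /mkset /set1.
    by rewrite nth_default ?size_tuple.
  by rewrite -[j]/(val (Ordinal jk)) -tnth_nth tnth_mktuple.
move=> Sh; split.
  by rewrite (Sh k) ?nth_default ?size_tuple//; apply/memP.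
apply: eq_from_tnth => i; rewrite tnth_mktuple (tnth_nth true).
by apply: Sh; apply/memP/ltnW.
Qed.

Lemma sigma_process_history (R : realType) (d : measure_display)
    (Omega : measurableType d) (P : probability Omega R)
    (S : nat -> {RV P >-> bool}) (k : nat) (h : k.-tuple bool) :
  sigma_process S [set w | S k w /\ [tuple S i w | i < k] = h].
Proof.
rewrite history_eventE.
apply: (@fin_bigcap_measurable _ (g_sigma_algebraType _)).
  exact: finite_seq.
by move=> j _; apply: sub_sigma_algebra; exists j, [set nth true h j].
Qed.

Lemma measurable_history (R : realType) (d : measure_display)
    (Omega : measurableType d) (P : probability Omega R)
    (S : nat -> {RV P >-> bool}) (k : nat) (h : k.-tuple bool) :
  measurable [set w | S k w /\ [tuple S i w | i < k] = h].
Proof.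
rewrite history_eventE; apply: fin_bigcap_measurable => [|j _].
  exact: finite_seq.
by rewrite -[_ @^-1` _]setTI; apply: measurable_funPT.
Qed.

Lemma iid_bernoulli_pmf (R : realType) (d : measure_display)
    (Omega : measurableType d) (P : probability Omega R) (q : R)
    (S : nat -> {RV P >-> bool}) (k : nat) (b : bool) :
  0 <= q <= 1 -> iid_bernoulli q S ->
  P (S k @^-1` [set b]) = (if b then q else 1 - q)%:E.
Proof.
move=> q01 [Sq _]; have := Sq k [set b].
rewrite /distribution /pushforward => ->.
rewrite bernoulli_probE// !diracE.
case: b.
  by rewrite (@mem_set _ [set true] true)// (@memNset _ [set true] false)// mule1
    mule0 adde0.
by rewrite (@mem_set _ [set false] false)// (@memNset _ [set false] true)// mule1
  mule0 add0e.
Qed.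

Lemma iid_bernoulli_history (R : realType) (d : measure_display)
    (Omega : measurableType d) (P : probability Omega R) (q : R)
    (S : nat -> {RV P >-> bool}) (k : nat) (h : k.-tuple bool) :
  0 <= q <= 1 -> iid_bernoulli q S ->
  P [set w | S k w /\ [tuple S i w | i < k] = h] =
  (q * bernoulli_weight q h)%:E.
Proof.
move=> q01 iidS; rewrite history_eventE.
rewrite iidS.2 ?iota_uniq//.
under eq_bigr do rewrite (iid_bernoulli_pmf _ _ q01 iidS).
rewrite (_ : iota 0 k.+1 = index_iota 0 k.+1); last first.
  by rewrite /index_iota subn0.
rewrite -(big_morph EFin (@EFinM R) erefl) big_mkord big_ord_recr/=.
rewrite nth_default ?size_tuple// mulrC; congr (_ * _)%:E.
by apply: eq_bigr => i _; rewrite -tnth_nth.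
Qed.

(** The sample space splits into [S k = false] and, for each history [h], the event [S k = true]
    with that history. On each of the latter events only [U] varies in the integrand, and [U] is
    independent of the event, which has probability [q * bernoulli_weight q h]. *)
Lemma expectation_causal (R : realType) (d : measure_display)
    (Omega : measurableType d) (P : probability Omega R) (q : R)
    (S : nat -> {RV P >-> bool}) (U : {RV P >-> R}) (k : nat)
    (g : k.-tuple bool -> R -> R) :
  0 <= q <= 1 -> iid_bernoulli q S -> uniform01 U ->
  independent_of_process U S ->
  (forall h, (uniform_prob (@ltr01 R)).-integrable setT (EFin \o g h)) ->
  (forall h u, 0 <= g h u) ->
  fine 'E_P[fun w => if S k w then g [tuple S i w | i < k] (U w) else 1] =
  1 - q + q * \sum_h bernoulli_weight q h
                      * \int[uniform_prob (@ltr01 R)]_u g h u.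
Proof.
move=> q01 iidS [_ Uu] indep ig g0.
pose A (h : k.-tuple bool) := [set w | S k w /\ [tuple S i w | i < k] = h].
have mA h : measurable (A h) by exact: measurable_history.
have mN : measurable (S k @^-1` [set false]).
  by rewrite -[_ @^-1` _]setTI; apply: measurable_funPT.
have mg h : measurable_fun setT (EFin \o g h) by exact: measurable_int (ig h).
have mgU h : measurable_fun setT (EFin \o (g h \o U)).
  exact: (measurableT_comp (mg h)).
pose F (h : k.-tuple bool) := (EFin \o (g h \o U)) \_ (A h).
have F0 h w : (0 <= F h w)%E.
  by rewrite /F patchE; case: ifP => _ //=; rewrite lee_fin.
have mF h : measurable_fun setT (F h).
  by apply/(measurable_restrictT _ (mA h)); exact: measurable_funTS.
have -> :
    ('E_P[fun w => if S k w then g [tuple S i w | i < k] (U w) else 1%R])%E =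
    (\int[P]_w ((cst 1%E \_ (S k @^-1` [set false])) w + \sum_h F h w))%E.
  rewrite unlock; apply: eq_integral => w _; rewrite patchE.
  have [Sk|Sk] := boolP (S k w).
    rewrite memNset/=; last by rewrite Sk.
    rewrite add0e (bigD1 [tuple S i w | i < k])//= big1 ?adde0.
      by rewrite /F patchE mem_set.
    by move=> h hh; rewrite /F patchE memNset// => -[_ e]; rewrite e eqxx in hh.
  rewrite mem_set/=; last exact: negbTE.
  by rewrite big1 ?adde0// => h _; rewrite /F patchE memNset// => -[/(negP Sk)].
have intF h : (\int[P]_w F h w =
    (q * (bernoulli_weight q h * \int[uniform_prob (@ltr01 R)]_u g h u))%:E)%E.
  rewrite /F -integral_mkcond.
  rewrite (@ge0_integral_indep_event _ _ _ _ _ P U (A h) (EFin \o g h))//.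
  - rewrite (iid_bernoulli_history _ q01 iidS) mulrA [RHS]EFinM.
    congr (_ * _)%E.
    transitivity (\int[uniform_prob (@ltr01 R)]_u (g h u)%:E)%E.
      (* [uniform_prob] lives on [measurableTypeR R], which carries the same
         sigma-algebra as [R] but another display. *)
      pose idTR : measurableTypeR R -> R := idfun.
      have mid : measurable_fun setT idTR by exact: measurable_id.
      rewrite -[RHS](@ge0_integral_pushforward _ _ _ _ _ _ mid _ setT
        (EFin \o g h))//; last first.
        by move=> u _; rewrite lee_fin.
      by apply: eq_measure_integral => B mB _; exact: Uu.
    by rewrite /Rintegral fineK//; apply: integrable_fin_num => //; exact: ig.
  - by move=> B mB; apply: indep => //; exact: sigma_process_history.
  - by move=> u; rewrite lee_fin.
rewrite ge0_integralD//; first last.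
- exact: emeasurable_sum.
- by move=> w _; exact: sume_ge0.
- by apply/(measurable_restrictT _ mN); exact: measurable_cst.
- by move=> w _; rewrite patchE; case: ifP.
rewrite -integral_mkcond integral_cst// mul1e.
rewrite [X in fine (X + _)%E](iid_bernoulli_pmf k false q01 iidS).
rewrite ge0_integral_sum//.
under eq_bigr do rewrite intF.
by rewrite sumEFin -EFinD/= mulr_sumr.
Qed.

(** * The optimal ratio and the concavity of the reward *)

(** With [s = sqrt (1 + q)] and [q = (s - 1) (s + 1)], both sides are [2 s / (1 + s)]. *)
Lemma optimal_ratioE_duration (R : rcfType) (q : R) : 0 < q ->
  2 - 2 / q * (- 1 + Num.sqrt (1 + q)) = 2 * (2 - optimal_duration q).
Proof.
move=> q0; rewrite /optimal_duration.
have s2 : Num.sqrt (1 + q) ^+ 2 = 1 + q by rewrite sqr_sqrtr// addr_ge0// ltW.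
have s0 := sqrtr_ge0 (1 + q); move: (Num.sqrt _) s2 s0 => s s2 s0.
have s1 : s - 1 != 0 by apply/eqP => s1; nra.
have -> : q = (s - 1) * (s + 1) by lra.
have s1' : s + 1 != 0 by rewrite gt_eqF//; lra.
by field; rewrite s1 addrC s1'.
Qed.

(** The optimality condition of fractional programming: for [theta = 2 * (2 - x)], the best expected
    value of [R - theta T] in one slot is zero. The two summands are the contributions of state 0
    and of state 1 at duration [x]. *)
Lemma lagrangian_optimal_duration (R : rcfType) (q : R)
    (x := optimal_duration q) :
  0 < q ->
  (1 - q) * (1 - 2 * (2 - x)) + q * (2 - (2 - x) ^+ 2 - 2 * (2 - x) * x) = 0.
Proof.
move=> q0; rewrite /x /optimal_duration.
have s2 : Num.sqrt (1 + q) ^+ 2 = 1 + q by rewrite sqr_sqrtr// addr_ge0// ltW.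
have s0 := sqrtr_ge0 (1 + q); move: (Num.sqrt _) s2 s0 => s s2 s0.
have -> : q = s ^+ 2 - 1 by lra.
by field; rewrite gt_eqF//; lra.
Qed.

Lemma optimal_duration_itv (R : rcfType) (q : R) :
  1 <= optimal_duration q <= 2.
Proof.
have s0 := sqrtr_ge0 (1 + q).
rewrite /optimal_duration lerDl invr_ge0 addr_ge0//=.
by rewrite [leRHS](_ : 2 = 1 + 1)// lerD2l invf_le1 ?lerDl// ltr_wpDr.
Qed.

Lemma bounded_probability_integrable (R : realType) (d : measure_display)
    (T : measurableType d) (P : probability T R) (x : T -> R) (M : R) :
  measurable_fun setT x -> (forall w, 0 <= x w <= M) ->
  P.-integrable setT (EFin \o x).
Proof.
move=> mx xM; apply: measurable_bounded_integrable => //.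
  by rewrite (le_lt_trans (probability_le1 _ _)) ?ltry.
exists M; split=> [|y My w _]; first exact: num_real.
by have /andP[x0 xM'] := xM w; rewrite /= ger0_norm// (le_trans xM')// ltW.
Qed.

Lemma Rintegral_probability_cst (R : realType) (d : measure_display)
    (T : measurableType d) (P : probability T R) (c : R) :
  \int[P]_w c = c.
Proof.
rewrite Rintegral_cst// -[RHS]mulr1; congr (_ * _).
by rewrite -[RHS]/(fine 1%E); congr fine; exact: probability_setT.
Qed.

Lemma Rintegral_duration_itv (R : realType) (d : measure_display)
    (T : measurableType d) (P : probability T R) (x : T -> R) :
  measurable_fun setT x -> (forall w, 1 <= x w <= 2) ->
  1 <= \int[P]_w x w <= 2.
Proof.
move=> mx x12.
have ix : P.-integrable setT (EFin \o x).
  apply: (@bounded_probability_integrable _ _ _ _ _ 2) => // w.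
  by have := x12 w; lra.
have ic (c : R) : P.-integrable setT (EFin \o (fun=> c)).
  exact: finite_measure_integrable_cst.
rewrite -{1}(Rintegral_probability_cst P 1) -(Rintegral_probability_cst P 2).
by apply/andP; split; apply: le_Rintegral => // w _; have := x12 w; lra.
Qed.

(** Jensen's inequality through the tangent line at the mean [m]: the line exceeds the reward by
    [(x w - m)^2], and its integral is its value at [m]. *)
Lemma Rintegral_reward_le (R : realType) (d : measure_display)
    (T : measurableType d) (P : probability T R) (x : T -> R) :
  measurable_fun setT x -> (forall w, 1 <= x w <= 2) ->
  \int[P]_w (2 - (2 - x w) ^+ 2) <= 2 - (2 - \int[P]_w x w) ^+ 2.
Proof.
move=> mx x12; set m := \int[P]_w x w.
have ix : P.-integrable setT (EFin \o x).
  apply: (@bounded_probability_integrable _ _ _ _ _ 2) => // w.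
  by have := x12 w; lra.
have ic (c : R) : P.-integrable setT (EFin \o (fun=> c)).
  exact: finite_measure_integrable_cst.
have iZ (c : R) : P.-integrable setT (EFin \o (fun w => c * x w)).
  rewrite (_ : _ \o _ = (fun w => c%:E * (EFin \o x) w)%E)//.
  exact: integrableZl.
pose a := 2 - (2 - m) ^+ 2 - 2 * (2 - m) * m.
have iD : P.-integrable setT (EFin \o (fun w => a + 2 * (2 - m) * x w)).
  exact: (integrableD measurableT (ic a) (iZ (2 * (2 - m)))).
have -> : 2 - (2 - m) ^+ 2 = \int[P]_w (a + 2 * (2 - m) * x w).
  rewrite RintegralD// ?RintegralZl// Rintegral_probability_cst -/m /a; ring.
apply: le_Rintegral => //.
  apply: (@bounded_probability_integrable _ _ _ _ _ 2) => [|w];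
    last by have := x12 w; nra.
  apply: measurable_funB => //; apply: measurable_funX.
  exact: measurable_funB.
by move=> w _; rewrite /a; have := sqr_ge0 (x w - m); nra.
Qed.

(** The upper bound integrates a pointwise bound on [R - theta T], whose mean vanishes by
    [lagrangian_optimal_duration]. It is attained by always choosing [x] in state 1. *)
Lemma optimal_ratioE (R : realType) (q : R) : 0 < q -> q <= 1 ->
  optimal_ratio q = 2 * (2 - optimal_duration q).
Proof.
move=> q0 q1; set x := optimal_duration q; set theta := 2 * (2 - x).
have /andP[x1 x2] : 1 <= x <= 2 := optimal_duration_itv q.
have q01 : 0 <= q <= 1 by lra.
have lagr := lagrangian_optimal_duration q0; rewrite -/x in lagr.
have ub : ubound [set p.2 / p.1 | p in achievable q] theta.
  move=> _ [_ [d [W [P [Y [t [r [Yq dec ->]]]]]]] <-] /=.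
  rewrite !unlock -/(Rintegral P setT t) -/(Rintegral P setT r).
  pose A := Y @^-1` [set true].
  have mA : measurable A.
    by rewrite /A -[_ @^-1` _]setTI; apply: measurable_funPT.
  have PA : P A = q%:E.
    have := Yq [set true]; rewrite /distribution /pushforward => ->.
    rewrite bernoulli_probE// !diracE.
    by rewrite (@mem_set _ [set true] true)// (@memNset _ [set true] false)// mule1
    mule0 adde0.
  have TR w : 1 <= t w <= 2 /\ r w = 2 - (2 - t w) ^+ 2.
    have := dec w; case: (Y w) => /=.
      by move=> [y]; rewrite in_itv/= => y12 [<- <-].
    by move=> [-> ->]; lra.
  have /andP[T1 T2] : 1 <= \int[P]_w t w <= 2.
    by apply: Rintegral_duration_itv => // w; have [] := TR w.
  have iT : P.-integrable setT (EFin \o t).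
    apply: (@bounded_probability_integrable _ _ _ _ _ 2) => // w.
    by have [] := TR w; lra.
  have iR : P.-integrable setT (EFin \o r).
    apply: (@bounded_probability_integrable _ _ _ _ _ 2) => // w.
    by have [+ ->] := TR w; nra.
  have ic (c : R) : P.-integrable setT (EFin \o (fun=> c)).
    exact: finite_measure_integrable_cst.
  have iZ (c : R) (y : W -> R) : P.-integrable setT (EFin \o y) ->
      P.-integrable setT (EFin \o (fun w => c * y w)).
    move=> iy; rewrite (_ : _ \o _ = (fun w => c%:E * (EFin \o y) w)%E)//.
    exact: integrableZl.
  have iA : P.-integrable setT (EFin \o \1_A) by exact: integrable_indic.
  (* The maximum of [R - theta T] over the decisions of state 1; in state 0 the value is always
     [1 - theta]. The indicator of [A] combines both cases in one affine bound. *)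
  pose v := 2 - (2 - x) ^+ 2 - theta * x.
  have iTA :=
    integrableD measurableT (iZ theta _ iT) (iZ (v - (1 - theta)) _ iA).
  have IA : \int[P]_w \1_A w = q.
    by rewrite /Rintegral integral_indic// setIT; exact: (congr1 fine PA).
  have RT : \int[P]_w r w <= \int[P]_w
      ((1 - theta) + (theta * t w + (v - (1 - theta)) * \1_A w)).
    apply: le_Rintegral => //.
      exact: (integrableD measurableT (ic (1 - theta)) iTA).
    move=> w _; rewrite indicE; have := dec w; rewrite /A.
    have [Sw|Sw] := boolP (Y w).
      rewrite mem_set//= => -[y _ [<- <-]]; rewrite /v /theta.
      by have := sqr_ge0 (y - x); nra.
    by rewrite memNset/=; [move=> [-> ->]; lra|exact/negP].
  rewrite ler_pdivrMr; last by lra.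
  apply: le_trans RT _.
  rewrite (RintegralD measurableT (ic (1 - theta)) iTA).
  rewrite (RintegralD measurableT (iZ theta _ iT) (iZ (v - (1 - theta)) _ iA)).
  rewrite !RintegralZl// Rintegral_probability_cst IA.
  have : (1 - theta) + (v - (1 - theta)) * q = 0.
    by rewrite -[RHS]lagr /v /theta; ring.
  by rewrite addrCA => ->; rewrite addr0.
(* The space of states itself, with its Bernoulli law, serves as probability space, the decision
   being a function of the state. *)
have optP : achievable q (q * x + (1 - q), q * (2 - (2 - x) ^+ 2) + (1 - q)).
  have mfun (y : bool -> R) : measurable_fun setT y by [].
  have mid : measurable_fun setT (@id bool) by exact: measurable_id.
  exists default_measure_display, bool, (bernoulli_prob q).
  exists (mfun_Sub (mem_set mid)).
  exists (mfun_Sub (mem_set (mfun (fun b => if b then x else 1)))).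
  exists (mfun_Sub (mem_set
    (mfun (fun b => if b then 2 - (2 - x) ^+ 2 else 1)))).
  split=> [B|[]|].
  - by [].
  - by exists x => //=; rewrite in_itv/= x1 x2.
  - by [].
  rewrite !unlock !integral_bernoulli_prob//=.
  - by rewrite !mulr1.
  - by case; rewrite lee_fin; nra.
  - by case; rewrite lee_fin; nra.
have xt : theta = (q * (2 - (2 - x) ^+ 2) + (1 - q)) / (q * x + (1 - q)).
  apply: (@mulIf _ (q * x + (1 - q))); first by rewrite gt_eqF//; nra.
  rewrite divfK; last by rewrite gt_eqF//; nra.
  by rewrite /theta; nra.
apply/eqP; rewrite eq_le; apply/andP; split.
  apply: ge_sup => //; eexists.
  by exists (q * x + (1 - q), q * (2 - (2 - x) ^+ 2) + (1 - q)).
apply: ub_le_sup; first by exists theta.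
by exists (q * x + (1 - q), q * (2 - (2 - x) ^+ 2) + (1 - q)).
Qed.

(** * The loss of a causal algorithm per slot and in total *)

(* The value 1 outside [0, 1], where [f] is unconstrained, makes the duration
   admissible and measurable everywhere. *)
Definition slot_duration (R : realType)
    (f : forall k : nat, k.-tuple bool * R -> R * R)
    (k : nat) (h : k.-tuple bool) (u : R) : R :=
  if u \in `[0, 1] then (f k (h, u)).1 else 1.

Lemma slot_duration_itv (R : realType)
    (f : forall k : nat, k.-tuple bool * R -> R * R) k h u :
  causal_measurable_algorithm f -> 1 <= @slot_duration R f k h u <= 2.
Proof.
move=> hf; rewrite /slot_duration; case: ifPn => [|_]; last by lra.
rewrite in_itv/= => u01; have [y] := (hf k).2 h u u01.
by rewrite /= in_itv/= => y12 <-.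
Qed.

Lemma measurable_slot_duration (R : realType)
    (f : forall k : nat, k.-tuple bool * R -> R * R) k h :
  causal_measurable_algorithm f -> measurable_fun setT (@slot_duration R f k h).
Proof.
move=> hf; have mf : measurable_fun `[0 : R, 1] (f k \o pair h).
  apply: (@measurable_comp _ _ _ _ _ _ ([set: k.-tuple bool] `*` `[0 : R, 1])).
  - exact: measurableX.
  - by move=> _ [u u01 <-].
  - exact: (hf k).1.
  - by apply: measurable_funTS; exact: pair1_measurable.
have pre01 : (fun u : R => u \in `[0, 1]) @^-1` [set true] = `[0, 1]%classic.
  by [].
rewrite /slot_duration; apply: measurable_fun_if => //.
  by apply: (measurable_fun_bool true); rewrite setTI pre01.
rewrite setTI pre01; exact: (measurableT_comp measurable_fst mf).
Qed.

(** Given the history [h], the mean duration [a h] is an estimator of [x] from [k] samples. Jensen's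
    inequality bounds the mean reward by the reward at [a h], which lies [(a h - x)^2] below the
    tangent line at [x]; the factor [q] is the probability of state 1. *)
Lemma expected_slot_decision (R : realType)
    (f : forall k : nat, k.-tuple bool * R -> R * R)
    (d : measure_display) (Omega : measurableType d) (P : probability Omega R)
    (q : R) (S : nat -> {RV P >-> bool}) (U : {RV P >-> R}) (k : nat)
    (a := fun h : k.-tuple bool =>
      \int[uniform_prob (@ltr01 R)]_u slot_duration f h u)
    (x := optimal_duration q)
    (t := fine 'E_P[fun w => (decision f S U k w).1])
    (r := fine 'E_P[fun w => (decision f S U k w).2]) :
  causal_measurable_algorithm f -> 0 < q -> q <= 1 ->
  iid_bernoulli q S -> uniform01 U -> independent_of_process U S ->
  1 <= t <= 2 /\
  r <= 2 * (2 - x) * t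
       - q * \sum_h bernoulli_weight q h * (a h - x) ^+ 2.
Proof.
move=> hf q0 q1 iidS U01 indep.
have q01 : 0 <= q <= 1 by lra.
have U01' w : U w \in `[0, 1] by rewrite in_itv/=; have := U01.1 w; lra.
have w0 h : 0 <= @bernoulli_weight R q k h.
  by apply: prodr_ge0 => i _; case: ifP => _; lra.
have sum_w := @sum_bernoulli_weight R q k.
have d12 h u := @slot_duration_itv R f k h u hf.
have md h := @measurable_slot_duration R f k h hf.
pose Q := uniform_prob (@ltr01 R).
have a12 h : 1 <= a h <= 2.
  exact: (@Rintegral_duration_itv _ _ _ Q _ (md h) (d12 h)).
have tE : t = 1 - q + q * \sum_h bernoulli_weight q h * a h.
  rewrite -[RHS](@expectation_causal _ _ _ P q S U k (@slot_duration R f k))//.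
  - congr (fine (expectation P _)); apply/funext => w.
    by rewrite /decision /slot_duration U01'; case: ifP.
  - move=> h; apply: (@bounded_probability_integrable _ _ _ Q _ 2 (md h)) => u.
    by have := d12 h u; lra.
  - by move=> h u; have := d12 h u; lra.
have mr (h : k.-tuple bool) :
    measurable_fun setT (fun u => 2 - (2 - slot_duration f h u) ^+ 2).
  apply: measurable_funB => //; apply: measurable_funX.
  exact: measurable_funB.
have r02 (h : k.-tuple bool) u : 0 <= 2 - (2 - slot_duration f h u) ^+ 2 <= 2.
  by have := d12 h u; nra.
have ir (h : k.-tuple bool) :=
  @bounded_probability_integrable _ _ _ Q _ 2 (mr h) (r02 h).
have r0 (h : k.-tuple bool) u : 0 <= 2 - (2 - slot_duration f h u) ^+ 2.
  by have /andP[] := r02 h u.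
have := @expectation_causal _ _ _ P q S U k
  (fun h u => 2 - (2 - slot_duration f h u) ^+ 2) q01 iidS U01 indep ir r0.
rewrite (_ : fine _ = r); last first.
  congr (fine (expectation P _)); apply/funext => w.
  rewrite /decision /slot_duration U01'; case: ifP => // _.
  have U01w : 0 <= U w <= 1 by have := U01.1 w; lra.
  by have [y _ <-] := (hf k).2 [tuple S i w | i < k] (U w) U01w.
move=> rE; clearbody r.
split.
  have : \sum_(h : k.-tuple bool) bernoulli_weight q h <=
      \sum_(h : k.-tuple bool) bernoulli_weight q h * a h.
    by apply: ler_sum => h _; rewrite ler_peMr//; have := a12 h; lra.
  have : \sum_(h : k.-tuple bool) bernoulli_weight q h * a h <=
      \sum_(h : k.-tuple bool) bernoulli_weight q h * 2.
    by apply: ler_sum => h _; rewrite ler_wpM2l//; have := a12 h; lra.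
  rewrite -mulr_suml sum_w tE; nra.
have le_r : r <= 1 - q + q * \sum_(h : k.-tuple bool)
    bernoulli_weight q h * (2 - (2 - a h) ^+ 2).
  rewrite rE lerD2l ler_pM2l//; apply: ler_sum => h _.
  rewrite ler_wpM2l//.
  exact: (@Rintegral_reward_le _ _ _ Q _ (md h) (d12 h)).
apply: le_trans le_r _; rewrite tE le_eqVlt; apply/orP; left; apply/eqP.
pose v := 2 - (2 - x) ^+ 2 - 2 * (2 - x) * x.
(* Expansion around [x]: [2 - (2 - y)^2 = v + 2 (2 - x) y - (y - x)^2]. The constant terms then
   cancel by the Lagrangian identity. *)
have -> : \sum_(h : k.-tuple bool) bernoulli_weight q h * (2 - (2 - a h) ^+ 2) =
    v + 2 * (2 - x) * (\sum_h bernoulli_weight q h * a h)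
    - \sum_h bernoulli_weight q h * (a h - x) ^+ 2.
  rewrite (_ : v = v * \sum_(h : k.-tuple bool) bernoulli_weight q h);
    last by rewrite sum_w mulr1.
  rewrite !mulr_sumr -sumrN -!big_split/=.
  by apply: eq_bigr => h _; rewrite /v; ring.
have := lagrangian_optimal_duration q0; rewrite -/x -/v => lagr.
by apply/eqP; rewrite -subr_eq0 -[X in _ == X]lagr; apply/eqP; ring.
Qed.

Theorem theorem4 (R : realType)
    (f : forall k : nat, k.-tuple bool * R -> R * R)
    (hf : causal_measurable_algorithm f) :
  exists q : R,
    [/\ 1 / 4 <= q <= 3 / 4,
        optimal_ratio q = 2 - 2 / q * (- 1 + Num.sqrt (1 + q))
      & forall (d : measure_display) (Omega : measurableType d)
          (P : probability Omega R)
          (S : nat -> {RV P >-> bool}) (U : {RV P >-> R}),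
        iid_bernoulli q S -> uniform01 U -> independent_of_process U S ->
        exists (c : R) (K0 : nat),
          [/\ 0 < c, (0 < K0)%N
            & forall K : nat, (K0 <= K)%N ->
              time_average_ratio f S U K
                <= optimal_ratio q - c * (ln K%:R / K%:R)]].
Proof.
(* These estimators depend on [f] alone, so [q] is fixed before any probability space is given. *)
pose a k (h : k.-tuple bool) :=
  \int[uniform_prob (@ltr01 R)]_u slot_duration f h u.
have [q q4 [c c0 cK]] := exists_log_error a.
have q0 : 0 < q by lra.
have q1 : q <= 1 by lra.
exists q; split=> //; first by rewrite optimal_ratioE// optimal_ratioE_duration.
move=> d Omega P S U iidS U01 indep.
(* The accumulated loss is at least [q * c * ln K], and it is divided by a total duration of at most
   [2 * K], since every duration is at most 2; hence the factor 1/2. The threshold 9 comes from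
   [exists_log_error]. *)
exists (q * c / 2), 9%N; split=> [|//|K K9].
  by rewrite divr_gt0// mulr_gt0.
have slot k := expected_slot_decision k hf q0 q1 iidS U01 indep.
rewrite /time_average_ratio optimal_ratioE//.
set theta := 2 * (2 - optimal_duration q).
set sR := \sum_(0 <= k < K) _; set sT := \sum_(0 <= k < K) _.
have K0 : 0 < K%:R :> R by rewrite ltr0n (leq_trans _ K9).
have KT : K%:R <= sT.
  rewrite -[K%:R](_ : \sum_(0 <= k < K) 1 = _); last first.
    by rewrite sumr_const_nat subn0.
  by apply: ler_sum => k _; have [/andP[]] := slot k.
have TK : sT <= 2 * K%:R.
  rewrite mulr_natr -[X in _ *+ X]subn0 -sumr_const_nat.
  by apply: ler_sum => k _; have [/andP[]] := slot k.
have RT : sR <= theta * sT - q * \sum_(0 <= k < K) mean_sq_error a k q.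
  rewrite !mulr_sumr -sumrB; apply: ler_sum => k _.
  by have [_] := slot k.
have := cK K K9; set M := \sum_(0 <= k < K) _ in RT * => lnM.
have T0 : 0 < sT by apply: lt_le_trans KT.
rewrite ler_pdivrMr// mulrBl; apply: le_trans RT _.
have -> : q * c / 2 * (ln K%:R / K%:R) * sT =
    q * (c * ln K%:R * (sT / (2 * K%:R))) by field; rewrite gt_eqF.
rewrite lerB// ler_pM2l//; apply: le_trans lnM.
rewrite ler_piMr//; last by rewrite ler_pdivrMr ?mul1r// mulr_gt0.
by rewrite mulr_ge0 ?(ltW c0)// ln_ge0// ler1n (leq_trans _ K9).
Qed.
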